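(* Let $\lambda=w_1w_2\cdots w_l$ be a word in the letters $N,E$ with $l\ge 1$, and let all notation ($P_k$, $B(P)$, $\Delta_k$, $a_{11}$, $a_{pq}$, $c([r,s])$, the sequences $\rho,\kappa$, quadruples and $\mathcal F(a,b)$) be as in the context. Then for every quadruple $(a,b)$, \[ c\big([\rho_{a+1},\kappa_b]\big)\,c\big([\rho_a,\kappa_{b+1}]\big)-c\big([\rho_{a+1},\kappa_{b+1}]\big)\,c\big([\rho_a,\kappa_b]\big)=\prod_{X\in\mathcal F(a,b)} X . \]
   Context: Lattice points: $P_1=(1,1)$ and, for $1\le k\le l$, $P_{k+1}=P_k+(0,1)$ if $w_k=N$ and $P_{k+1}=P_k+(1,0)$ if $w_k=E$. The $a_{ij}$ ($i,j\in\mathbb Z$) are independent indeterminates. For a lattice point $P=(x,y)$ let $B(P)$ be the $2\times 2$ matrix with first (top) row $(a_{x,y+1},a_{x+1,y+1})$ and second (bottom) row $(a_{x,y},a_{x+1,y})$, and set $\Delta_k=\det B(P_k)$ for $1\le k\le l+1$. Let $p=2+\#\{k:w_k=E\}$, $q=2+\#\{k:w_k=N\}$. For a $2\times2$ matrix $B$ (a ''block''), $h_+(B),h_-(B)$ denote its top and bottom rows and $v_-(B),v_+(B)$ its left and right columns. A horizontal (vertical) domino is a $1\times 2$ ($2\times 1$) matrix. DRH matrices: given a sequence $X_0,X_1,\dots,X_n$ of dominoes and blocks, place them successively in the plane as arrays of unit cells, $X_t$ being placed either directly above $X_{t-1}$ (its bottom edge on the top edge of $X_{t-1}$, left edges aligned)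 or directly to the right of $X_{t-1}$ (its left edge on the right edge of $X_{t-1}$, bottom edges aligned); the directions alternate, the first being ''above'' if $X_0$ is a horizontal domino and ''right'' if $X_0$ is a vertical domino. The DRH matrix $X_0X_1\cdots X_n$ is the smallest rectangle containing all pieces, with the pieces' entries in their cells and $0$ in all other cells, with rows read top to bottom and columns left to right. Subskeleta: for $1\le r\le s\le l$, $[r,s]$ denotes the subword $w_r\cdots w_s$; its endpoints are the indices $r$ and $s+1$, and its bends are the indices $k$ with $r<k\le s$ and $w_{k-1}\ne w_k$. If $k_1<\dots<k_m$ are the bends of $[r,s]$, let $X_0=h_-(B(P_r))$ if $w_r=N$ and $X_0=v_-(B(P_r))$ if $w_r=E$, and $X_{m+1}=h_+(B(P_{s+1}))$ if $w_s=N$ and $X_{m+1}=v_+(B(P_{s+1}))$ if $w_s=E$; the standardization $\mathrm{Std}([r,s])$ is the DRH matrix $X_0B(P_{k_1})\cdots B(P_{k_m})X_{m+1}$, which is an $\eta\times\eta$ matrix, and $c([r,s])=(-1)^{(\eta-1)(\eta-2)/2}\det\mathrm{Std}([r,s])$. Let $e_1<\dots<e_\varepsilon$ be the indices $k$ with $w_k=E$ and $n_1<\dots<n_\nu$ those with $w_k=N$. Put $\rho=(\rho_1,\dots,\rho_l)=(e_\varepsilon,\dots,e_1,n_1,\dots,n_\nu)$ and $\kappa=(\kappa_1,\dots,\kappa_l)=(e_1,\dots,e_\varepsilon,n_\nu,\dots,n_1)$. A quadruple is a pair $(a,b)$ with $1\le a,b\le l-1$ such that $\rho_{a'}\le\kappa_{b'}$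 for all $a'\in\{a,a+1\}$, $b'\in\{b,b+1\}$. For a quadruple, let $\mu'=[\max(\rho_a,\rho_{a+1}),\min(\kappa_b,\kappa_{b+1})]$ and $\mu''=[\min(\rho_a,\rho_{a+1}),\max(\kappa_b,\kappa_{b+1})]$. Define the set $\mathcal F(a,b)$ to consist of: $\Delta_k$ for each bend $k$ of $\mu'$; $\Delta_k$ for each endpoint $k$ of $\mu''$; $\Delta_k$ for each endpoint $k$ of $\mu'$ that is a bend of $\mu''$; with the modifications that if $\kappa_b$ is an $E$-index and $\kappa_{b+1}$ an $N$-index then $\Delta_{l+1}$ is removed and $a_{pq}$ inserted, and if $\rho_a$ is an $E$-index and $\rho_{a+1}$ an $N$-index then $\Delta_1$ is removed and $a_{11}$ inserted. *)

(* Defs.v *)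
From HB Require Import structures.
From mathcomp Require Import all_boot all_order all_algebra.
From mathcomp Require Import zify.
From mathcomp Require Export finmap.
From mathcomp Require Export monalg.

Set Implicit Arguments.
Unset Strict Implicit.
Unset Printing Implicit Defensive.

Import GRing.Theory.

Local Open Scope fset_scope.
Local Open Scope ring_scope.

(* The monomials are finitely supported exponent vectors on Z^2, so this is the
   polynomial ring over R in the independent indeterminates a_{ij}. *)
Notation apoly R := {malg R[{cmonom (int * int)%type}]}.

Definition indet (R : comNzRingType) (i j : int) : apoly R :=
  << ucm (i, j) >>.

Inductive letter := North | East.

Definition is_north (x : letter) : bool := if x is North then true else false.
Definition letter_of_bool (b : bool) : letter := if b then North else East.
Lemma is_northK : cancel is_north letter_of_bool. Proof. by case. Qed.
HB.instance Definition _ :=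
  hasDecEq.Build letter (inj_eqAxiom (can_inj is_northK)).

(* Letters, lattice points, rho and kappa are numbered from 1; the values at
   index 0 or beyond the range are junk. *)
Definition letter_at (w : seq letter) (k : nat) : letter := nth North w k.-1.

Definition step (x : letter) : int * int :=
  if x is North then (0, 1) else (1, 0).

Fixpoint walk (w : seq letter) (n : nat) : int * int :=
  if n is n'.+1 then walk w n' + step (letter_at w n) else (1, 1).

Definition point (w : seq letter) (k : nat) : int * int := walk w k.-1.

(* These are p and q: the corners of the shape are a_{11} and a_{pq}. *)
Definition ncols (w : seq letter) : nat := 2 + count_mem East w.
Definition nrows (w : seq letter) : nat := 2 + count_mem North w.

Definition Bmat (S : comNzRingType) (a : int -> int -> S) (P : int * int) :
    'M[S]_2 :=
  \matrix_(i < 2, j < 2) a (P.1 + j%:Z) (P.2 + 1 - i%:Z).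

Definition Delta (S : comNzRingType) (a : int -> int -> S) (w : seq letter)
    (k : nat) : S :=
  \det (Bmat a (point w k)).

Definition h_plus (S : comNzRingType) (B : 'M[S]_2) : 'rV[S]_2 := row 0 B.
Definition h_minus (S : comNzRingType) (B : 'M[S]_2) : 'rV[S]_2 := row 1 B.
Definition v_minus (S : comNzRingType) (B : 'M[S]_2) : 'cV[S]_2 := col 0 B.
Definition v_plus (S : comNzRingType) (B : 'M[S]_2) : 'cV[S]_2 := col 1 B.

Inductive piece (S : Type) :=
  | HDomino of 'rV[S]_2
  | VDomino of 'cV[S]_2
  | Block of 'M[S]_2.

Definition pheight (S : Type) (X : piece S) : nat :=
  if X is HDomino _ then 1 else 2.
Definition pwidth (S : Type) (X : piece S) : nat :=
  if X is VDomino _ then 1 else 2.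

(* Entry in row i (from the top) and column j (from the left); the calls to
   inord are only meaningful for i < pheight X and j < pwidth X. *)
Definition pentry (S : Type) (X : piece S) (i j : nat) : S :=
  match X with
  | HDomino v => v 0 (inord j)
  | VDomino v => v (inord i) 0
  | Block B => B (inord i) (inord j)
  end.

(* Each piece is paired with the coordinates of its bottom left cell; [up] tells
   whether the piece that follows the head goes above it or to its right. *)
Fixpoint place (S : Type) (up : bool) (x y : nat) (Xs : seq (piece S)) :
    seq ((nat * nat) * piece S) :=
  if Xs is X :: Xs' then
    ((x, y), X) :: (if up then place false x (y + pheight X) Xs'
                    else place true (x + pwidth X) y Xs')
  else [::].

(* A sequence starting with a block, for which no first direction is prescribed,
   is given the direction "right". *)
Definition starts_up (S : Type) (Xs : seq (piece S)) : bool :=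
  if Xs is HDomino _ :: _ then true else false.

Definition placed (S : Type) (Xs : seq (piece S)) :
    seq ((nat * nat) * piece S) :=
  place (starts_up Xs) 0 0 Xs.

(* All cells have nonnegative coordinates and the first piece covers (0, 0), so
   the smallest rectangle has its bottom left cell at (0, 0). *)
Definition drh_height (S : Type) (Xs : seq (piece S)) : nat :=
  \max_(Z <- placed Xs) (Z.1.2 + pheight Z.2).
Definition drh_width (S : Type) (Xs : seq (piece S)) : nat :=
  \max_(Z <- placed Xs) (Z.1.1 + pwidth Z.2).

(* Content of the cell (x, y), y counted upwards; the pieces never overlap. *)
Fixpoint cell (S : comNzRingType) (Zs : seq ((nat * nat) * piece S))
    (x y : nat) : S :=
  if Zs is ((x0, y0), X) :: Zs' then
    if (x0 <= x < x0 + pwidth X)%N && (y0 <= y < y0 + pheight X)%N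
    then pentry X ((pheight X).-1 - (y - y0)) (x - x0)
    else cell Zs' x y
  else 0.

Definition drh (S : comNzRingType) (Xs : seq (piece S)) :
    'M[S]_(drh_height Xs, drh_width Xs) :=
  \matrix_(i < drh_height Xs, j < drh_width Xs)
    cell (placed Xs) j ((drh_height Xs).-1 - i).

(* The interval [r, s] is represented by its two bounds. *)
Definition endpoints (r s : nat) : seq nat := [:: r; s.+1].
Definition bends (w : seq letter) (r s : nat) : seq nat :=
  [seq k <- iota r.+1 (s - r) | letter_at w k.-1 != letter_at w k].

Definition std_first (S : comNzRingType) (a : int -> int -> S)
    (w : seq letter) (r : nat) : piece S :=
  if letter_at w r is North then HDomino (h_minus (Bmat a (point w r)))
  else VDomino (v_minus (Bmat a (point w r))).
Definition std_last (S : comNzRingType) (a : int -> int -> S)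
    (w : seq letter) (s : nat) : piece S :=
  if letter_at w s is North then HDomino (h_plus (Bmat a (point w s.+1)))
  else VDomino (v_plus (Bmat a (point w s.+1))).

Definition std_pieces (S : comNzRingType) (a : int -> int -> S)
    (w : seq letter) (r s : nat) : seq (piece S) :=
  std_first a w r ::
    [seq Block (Bmat a (point w k)) | k <- bends w r s] ++
    [:: std_last a w s].

Definition eta (w : seq letter) (r s : nat) : nat := (size (bends w r s)).+2.

(* conform_mx is just a cast when r <= s; see std_dim below. *)
Definition std (S : comNzRingType) (a : int -> int -> S) (w : seq letter)
    (r s : nat) : 'M[S]_(eta w r s) :=
  conform_mx 0 (drh (std_pieces a w r s)).

Definition c (S : comNzRingType) (a : int -> int -> S) (w : seq letter)
    (r s : nat) : S :=
  (-1) ^+ (((eta w r s - 1) * (eta w r s - 2)) %/ 2) * \det (std a w r s).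

Definition indices (x : letter) (w : seq letter) : seq nat :=
  [seq k <- iota 1 (size w) | letter_at w k == x].

Definition rho_seq (w : seq letter) : seq nat :=
  rev (indices East w) ++ indices North w.
Definition kappa_seq (w : seq letter) : seq nat :=
  indices East w ++ rev (indices North w).
Definition rho (w : seq letter) (a : nat) : nat := nth 0 (rho_seq w) a.-1.
Definition kappa (w : seq letter) (b : nat) : nat := nth 0 (kappa_seq w) b.-1.

Definition quadruple (w : seq letter) (a b : nat) : Prop :=
  [/\ (1 <= a <= size w - 1)%N,
      (1 <= b <= size w - 1)%N &
      forall a' b' : nat, a' \in [:: a; a.+1] -> b' \in [:: b; b.+1] ->
        (rho w a' <= kappa w b')%N].

Definition Fset (S : comNzRingType) (A : int -> int -> S) (w : seq letter)
    (a b : nat) : {fset S} :=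
  let r' := maxn (rho w a) (rho w a.+1) in
  let s' := minn (kappa w b) (kappa w b.+1) in
  let r'' := minn (rho w a) (rho w a.+1) in
  let s'' := maxn (kappa w b) (kappa w b.+1) in
  let F0 :=
    [fset Delta A w k | k in bends w r' s'] `|`
    [fset Delta A w k | k in endpoints r'' s''] `|`
    [fset Delta A w k | k in [seq k <- endpoints r' s' | k \in bends w r'' s'']]
  in
  let F1 :=
    if (kappa w b \in indices East w) && (kappa w b.+1 \in indices North w)
    then A (ncols w)%:Z (nrows w)%:Z |` (F0 `\ Delta A w (size w).+1)
    else F0 in
  if (rho w a \in indices East w) && (rho w a.+1 \in indices North w)
  then A 1 1 |` (F1 `\ Delta A w 1)
  else F1.

Lemma place_blocks_dim (S : comNzRingType) (Bs : seq 'M[S]_2) (L : piece S)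
    (up : bool) (x y : nat) :
  (if up (+) odd (size Bs) then exists v, L = VDomino v
   else exists v, L = HDomino v) ->
  let Zs := place up x y ([seq Block B | B <- Bs] ++ [:: L]) in
  (\max_(Z <- Zs) (Z.1.2 + pheight Z.2) = y + (size Bs + 1 + up))%N /\
  (\max_(Z <- Zs) (Z.1.1 + pwidth Z.2) = x + (size Bs + 1 + ~~ up))%N.
Proof.
elim: Bs up x y => [|B Bs IH] up x y /=.
  rewrite addbF; case: up => -[v ->] /=;
    by rewrite !big_cons !big_nil /= !maxn0.
move=> H; rewrite !big_cons /=; case: up H => /= H.
  have [|-> ->] := IH false x (y + 2)%N; first by rewrite -[odd _]negbK.
  by split; rewrite ?(maxn_idPr _) //; lia.
have [|-> ->] := IH true (x + 2)%N y; first by [].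
by split; rewrite ?(maxn_idPr _) //; lia.
Qed.

Lemma odd_bends (w : seq letter) (r s : nat) : (r <= s)%N ->
  odd (size (bends w r s)) = (letter_at w r != letter_at w s).
Proof.
move=> /subnKC <-; elim: (s - r)%N => [|n IH].
  by rewrite addn0 /bends subnn /= eqxx.
have iotaS : iota r.+1 n.+1 = iota r.+1 n ++ [:: (r + n).+1].
  by rewrite -[n.+1]addn1 iotaD addSn.
move: IH; rewrite /bends !addKn iotaS filter_cat size_cat oddD => ->.
rewrite addnS /=.
by case: (letter_at w r); case: (letter_at w (r + n));
   case: (letter_at w (r + n).+1).
Qed.

Lemma std_dim (S : comNzRingType) (a : int -> int -> S) (w : seq letter)
    (r s : nat) : (r <= s)%N ->
  drh_height (std_pieces a w r s) = eta w r s /\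
  drh_width (std_pieces a w r s) = eta w r s.
Proof.
move=> le_rs; have ob := odd_bends w le_rs.
rewrite /drh_height /drh_width /placed /std_pieces /eta.
have -> : [seq Block (Bmat a (point w k)) | k <- bends w r s] =
   [seq Block B | B <- [seq Bmat a (point w k) | k <- bends w r s]].
  by rewrite -map_comp.
set Bs := [seq Bmat a _ | k <- _].
have <- : size Bs = size (bends w r s) by rewrite size_map.
rewrite /std_first /std_last; move: ob.
rewrite -(size_map (fun k => Bmat a (point w k))) -/Bs.
case: (letter_at w r); case: (letter_at w s) => /= ob; rewrite !big_cons /=;
  match goal with |- context [place ?u ?x ?y (_ ++ [:: ?L])] =>
    have [|E1 E2] := @place_blocks_dim S Bs L u x y;
    [by rewrite ob /=; eexists|
     by rewrite E1 E2; split; rewrite ?(maxn_idPr _) //; lia]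
  end.
Qed.

(* Main.v *)
(* Expanding the determinant of a DRH matrix along the row or column of its first
   domino leaves DRH matrices with one block fewer, so c([r,s]) is a product
   u_r T v_s of a row vector read off at P_r, one 2x2 transfer matrix of
   determinant Delta_k for each bend k, and a column vector read off at P_{s+1}.
   All four intervals of a quadruple share the transfer matrix M of mu', so the
   left-hand side of the theorem is a 2x2 determinant of scalars u M v, and it
   factors as det(u, u') (det M) det(v, v').  The middle factor is the product of
   the Delta_k over the bends of mu', and the outer two, which involve consecutive
   entries of rho and kappa, are the remaining elements of F(a,b). *)
Require Import Defs.
From mathcomp Require Import all_boot all_order all_algebra.
From mathcomp Require Import zify ring.

Set Implicit Arguments.
Unset Strict Implicit.
Unset Printing Implicit Defensive.

Import GRing.Theory.

Local Open Scope ring_scope.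

(** * Determinants of DRH matrices *)

Section DrhDeterminant.

Variable S : comNzRingType.
Implicit Types (u v : 'rV[S]_2) (B : 'M[S]_2) (Bs : seq 'M[S]_2).

Lemma det2 (M : 'M[S]_2) : \det M = M 0 0 * M 1 1 - M 0 1 * M 1 0.
Proof.
have lift00 : lift 0 0 = 1 :> 'I_2 by exact/val_inj.
have lift10 : lift 1 0 = 0 :> 'I_2 by exact/val_inj.
rewrite (expand_det_row _ 0) big_ord_recl big_ord1 lift00 /cofactor !det_mx11.
by rewrite !mxE /= lift00 lift10 expr0 expr1; ring.
Qed.

Definition mx22 (p q r s : S) : 'M[S]_2 :=
  \matrix_(i < 2, j < 2)
    if i == 0 then if j == 0 then p else q else if j == 0 then r else s.

Lemma inord0 : inord 0 = 0 :> 'I_2. Proof. by apply/val_inj; rewrite /= inordK. Qed.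
Lemma inord1 : inord 1 = 1 :> 'I_2. Proof. by apply/val_inj; rewrite /= inordK. Qed.

Definition domino (up : bool) u : piece S :=
  if up then HDomino u else VDomino u^T.

(* If X = (u0, u1) is horizontal, then the determinant of X B Y ... is, up to sign,
   u1 times that of (col 0 B) Y ... minus u0 times that of (col 1 B) Y ..., hence
   that of (u *m turn true B) Y ....  Vertical dominoes are read top to bottom. *)
Definition turn (up : bool) B : 'M[S]_2 :=
  if up then mx22 (- B 0 1) (- B 1 1) (B 0 0) (B 1 0)
  else mx22 (B 1 0) (B 1 1) (- B 0 0) (- B 0 1).

(** When no block is left, the two dominoes form a 2x2 matrix: u and v as columns if both are
    vertical, v above u as rows if both are horizontal. Its determinant is the pairing of u with
    this vector; the horizontal case has the opposite sign because u is then the bottom row. *)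
Definition covec (up : bool) v : 'cV[S]_2 :=
  (-1) ^+ up *: \col_(i < 2) (if i == 0 then v 0 1 else - v 0 0).

Fixpoint chain (up : bool) Bs : 'M[S]_2 :=
  if Bs is B :: Bs' then turn up B *m chain (~~ up) Bs' else 1%:M.

Lemma det_turn up B : \det (turn up B) = \det B.
Proof. by rewrite !det2; case: up; rewrite !mxE /=; ring. Qed.

Lemma cell_shift (Xs : seq (piece S)) up x0 y0 dx dy x y :
  cell (place up (x0 + dx) (y0 + dy) Xs) (x + dx) (y + dy) =
  cell (place up x0 y0 Xs) x y.
Proof.
elim: Xs up x0 y0 => [//|X Xs IH] up x0 y0 /=.
rewrite !(addnAC _ dx) !(addnAC _ dy) !leq_add2r !ltn_add2r !subnDr.
by case: ifP => // _; case: up; rewrite IH.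
Qed.

Lemma cell_left (Xs : seq (piece S)) up x0 y0 x y :
  (x < x0)%N || (y < y0)%N -> cell (place up x0 y0 Xs) x y = 0.
Proof.
elim: Xs up x0 y0 => [//|X Xs IH] up x0 y0 lt_xy /=.
case: ifP => [H|_]; first by exfalso; lia.
by case: up; apply: IH; lia.
Qed.

(** Unlike in [drh], size and first direction are parameters, so that minors are again of this form
    without casts. *)
Definition cells_mx n (Xs : seq (piece S)) up : 'M[S]_n :=
  \matrix_(i < n, j < n) cell (place up 0 0 Xs) j (n.-1 - i).

(** The domino u fills the first two cells of the bottom row, and B stands on it. Deleting that row
    and one of these two columns leaves the other column of B as the new first domino, and the
    pieces after B move by (-1, -1). *)
Lemma cells_mx_up n u B Xs (j : 'I_n.+2) (j' : 'I_2) :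
  (j = 1 - j' :> nat)%N ->
  row' ord_max (col' j (cells_mx n.+2 (HDomino u :: Block B :: Xs) true))
  = cells_mx n.+1 (domino false (col j' B)^T :: Xs) false.
Proof.
move=> jE; apply/matrixP => -[i lt_in] [k lt_kn].
rewrite !mxE /= /bump; have lt_j := ltn_ord j'.
rewrite (_ : (n < i)%N = false) /=; last by lia.
rewrite add0n (_ : (n.+1 - i = (n - i).+1)%N); last by lia.
set y := (n - i)%N; rewrite /= !add0n andbF trmxK.
case: k lt_kn => [|k] /= lt_kn.
  rewrite leqn0 (_ : (j == 0 :> nat) + 0 = j')%N; last by lia.
  rewrite lt_j add1n !ltnS /= -ltnS; case: (ltnP y 2) => y2.
    rewrite mxE !subn0 subn1 /=; congr (B _ _).
    exact/val_inj/inordK.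
  by rewrite !cell_left //; lia.
rewrite (_ : (j <= k.+1)%N = true) /=; last by lia.
rewrite !addSn !add0n /= -[k.+2]addn1 -[y.+1]addn1.
exact: (cell_shift Xs true 1 0 1 1).
Qed.

(** The mirror case: u fills the last two cells of the first column, so the deleted row is n or n +
    1, and the other row of B survives. *)
Lemma cells_mx_right n u B Xs (i : 'I_n.+2) (i' : 'I_2) :
  (i = n + i' :> nat)%N ->
  row' i (col' 0 (cells_mx n.+2 (domino false u :: Block B :: Xs) false))
  = cells_mx n.+1 (domino true (row (1 - i') B) :: Xs) true.
Proof.
move=> iE; apply/matrixP => -[k lt_kn] [j lt_jn].
rewrite !mxE /= /bump !add0n; have lt_i := ltn_ord i'; rewrite subn0.
case: (ltnP k n) => [lt_k|ge_k].
  rewrite (_ : (i <= k)%N = false) /=; last by lia.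
  rewrite (_ : (n.+1 - k = (n - k).+1)%N); last by lia.
  rewrite (_ : (n - k < 1)%N = false) ?andbF /=; last by lia.
  rewrite (_ : ((n - k).+1 < 2)%N = false) ?andbF /=; last by lia.
  by rewrite add1n -[RHS](cell_shift _ _ _ _ 1 1) !addn1.
have [-> ->] : (n - k = 0 /\ n.+1 - ((i <= k) + k) = i')%N by split; lia.
rewrite lt_i add1n ltnS; case: (ltnP j 2) => j2 /=.
  rewrite mxE subn1 /= !subn0; congr (B _ _).
  by apply/val_inj; case: i' lt_i {iE} => -[|[|]] //= *; rewrite inordK.
by rewrite !cell_left //; lia.
Qed.

(** For eta = m + 2 the sign in c has the triangular number (m+1)m/2 as exponent, so one more block
    adds m + 1 to it. *)
Lemma sign_triangle m :
  (-1) ^+ ((m.+2 * m.+1) %/ 2) = (-1) ^+ ((m.+1 * m) %/ 2) * (-1) ^+ m.+1 :> S.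
Proof.
by rewrite -exprD (_ : m.+2 * m.+1 = m.+1 * 2 + m.+1 * m)%N ?divnMDl 1?addnC //; lia.
Qed.

Lemma det_cells_up n u B Xs :
  \det (cells_mx n.+2 (domino true u :: Block B :: Xs) true) =
  (-1) ^+ n.+1 *
    (u 0 0 * \det (cells_mx n.+1 (domino false (col 1 B)^T :: Xs) false) -
     u 0 1 * \det (cells_mx n.+1 (domino false (col 0 B)^T :: Xs) false)).
Proof.
have lt1n : (1 < n.+2)%N by [].
rewrite (expand_det_row _ ord_max) (bigD1 0) // (bigD1 (Ordinal lt1n)) //=.
rewrite big1 => [|j /andP[j0 j1]]; last first.
  rewrite mxE subnn; move: (_ :: Xs) => Ys /=; case: ifP => [lt_j|_].
    by case: j lt_j j0 j1 => -[|[|]].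
  by rewrite cell_left ?mul0r.
rewrite addr0 /cofactor (cells_mx_up _ _ _ (j' := 1)) //.
rewrite (cells_mx_up _ _ _ (j' := 0)) // !mxE /= subnn !subn0 inord0 inord1.
by rewrite !add0n /= !exprD expr1 expr0; ring.
Qed.

Lemma det_cells_right n u B Xs :
  \det (cells_mx n.+2 (domino false u :: Block B :: Xs) false) =
  (-1) ^+ n *
    (u 0 0 * \det (cells_mx n.+1 (domino true (row 1 B) :: Xs) true) -
     u 0 1 * \det (cells_mx n.+1 (domino true (row 0 B) :: Xs) true)).
Proof.
have ltn2 : (n < n.+2)%N by [].
have ltn2_max : Ordinal ltn2 != ord_max by rewrite -val_eqE /= ltn_eqF.
rewrite (expand_det_col _ 0) (bigD1 ord_max) // (bigD1 (Ordinal ltn2)) //=.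
rewrite big1 => [|i /andP[i0 i1]]; last first.
  rewrite mxE; move: (_ :: Xs) => Ys /=; case: ifP => [|_].
    by case: i i0 i1 => i lt_i; rewrite -!val_eqE /=; lia.
  by rewrite cell_left ?mul0r.
rewrite addr0 /cofactor (cells_mx_right _ _ _ (i' := 1)) ?addn1 //.
rewrite (cells_mx_right _ _ _ (i' := 0)) ?addn0 // subrr subr0 !mxE /=.
rewrite subnn subSnn !add0n /= !mxE inord0 inord1 exprS.
by rewrite /domino; ring.
Qed.

(** Induction on the blocks: one expansion replaces u by [u *m turn up B] and flips the direction.
    Alternation forces the orientation [e] of the last domino. *)
Lemma det_cells up u Bs v (m := size Bs) (e := up (+) odd m) :
  (-1) ^+ ((m.+1 * m) %/ 2) *
    \det (cells_mx m.+2
      (domino up u :: [seq Block B | B <- Bs] ++ [:: domino e v]) up)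
  = (u *m chain up Bs *m covec e v) 0 0.
Proof.
rewrite {}/e {}/m; elim: Bs up u => [|B Bs IH] up u.
  have lift00 : lift 0 0 = 1 :> 'I_2 by exact/val_inj.
  rewrite mulmx1 det2 !mxE big_ord_recl big_ord1 lift00 !mxE.
  (* The cell formula leaves [inord] of unreduced arithmetic, in which the ordinal 1 of ['I_2] shows
     as [1 %% 2]. *)
  have E0 : inord (1 - (1 - 1 %% 2 - 0)) = 1 :> 'I_2 by exact: inord1.
  have E1 : inord (1 - (1 - 0 - 0)) = 0 :> 'I_2 by exact: inord0.
  have E2 : inord (1 %% 2 - 0) = 1 :> 'I_2 by exact: inord1.
  have E3 : inord (0 - 0) = 0 :> 'I_2 by exact: inord0.
  by case: up => /=; rewrite ?E0 ?E1 ?E2 ?E3 ?mxE; ring.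
rewrite [size _]/= sign_triangle.
have -> : up (+) odd (size Bs).+1 = ~~ up (+) odd (size Bs).
  by rewrite /=; case: (up) (odd _) => [] [].
rewrite map_cons cat_cons; set Xs := _ ++ _; set v' := covec _ _.
pose sgn : S := (-1) ^+ (((size Bs).+1 * size Bs) %/ 2).
have {}IH u' : (u' *m chain (~~ up) Bs *m v') 0 0
    = sgn * \det (cells_mx (size Bs).+2 (domino (~~ up) u' :: Xs) (~~ up)).
  by rewrite -IH.
(* The vectors on the right are, up to sign, the first dominoes of the two minors in the
   expansion. *)
have uE : u *m turn up B = u 0 1 *: (if up then (col 0 B)^T else - row 0 B)
   + u 0 0 *: (if up then - (col 1 B)^T else row 1 B).
  apply/rowP => j; rewrite mxE big_ord_recl big_ord1 (_ : lift 0 0 = 1);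
    last exact/val_inj.
  have /orP[/eqP->|/eqP->] : (j == 0) || (j == 1) by case: j => -[|[|]].
    by case: (up); rewrite !mxE /=; ring.
  by case: (up); rewrite !mxE /=; ring.
rewrite [chain _ _]/= mulmxA uE !mulmxDl -!scalemxAl.
(* With m the size of [Bs], [sign_triangle] contributes (-1)^(m+1) and the expansion (-1)^(m+2)
   upwards or (-1)^(m+1) to the right. The total is -1 or 1, which is the sign built into [turn]. *)
have sgn2 : (-1) ^+ (size Bs).+1 * (-1) ^+ (size Bs).+1 = 1 :> S.
  by rewrite -exprMn mulrNN mulr1 expr1n.
have oppE (M : 'M[S]_1) : (- M) 0 0 = - M 0 0 by rewrite mxE.
rewrite mxE [X in X + _]mxE [X in _ + X]mxE -/sgn.
clearbody sgn Xs v'; case: up uE IH => uE IH.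
  rewrite det_cells_up !mulNmx oppE !IH [(-1) ^+ _.+2]exprS mulN1r.
  move: (_ ^+ _) sgn2 => t sgn2; rewrite -[RHS]mul1r -sgn2 /=; ring.
rewrite det_cells_right !mulNmx oppE !IH.
by move: (_ ^+ _) sgn2 => t sgn2; rewrite -[RHS]mul1r -sgn2 /=; ring.
Qed.

End DrhDeterminant.

(** * Transfer matrices *)

Section Chain.

Variable S : comNzRingType.

Lemma chain_cat up (Bs Cs : seq 'M[S]_2) :
  chain up (Bs ++ Cs) = chain up Bs *m chain (up (+) odd (size Bs)) Cs.
Proof.
elim: Bs up => [|B Bs IH] up /=; first by rewrite mul1mx addbF.
by rewrite IH mulmxA addbN addNb.
Qed.

Lemma det_chain up (Bs : seq 'M[S]_2) :
  \det (chain up Bs) = \prod_(B <- Bs) \det B.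
Proof.
elim: Bs up => [|B Bs IH] up /=; first by rewrite det1 big_nil.
by rewrite det_mulmx det_turn IH big_cons.
Qed.

Definition wedge (u v : 'rV[S]_2) := u 0 0 * v 0 1 - u 0 1 * v 0 0.
Definition cowedge (u v : 'cV[S]_2) := u 0 0 * v 1 0 - u 1 0 * v 0 0.

Lemma mulmx2E m n (M : 'M[S]_(m, 2)) (N : 'M[S]_(2, n)) i j :
  (M *m N) i j = M i 0 * N 0 j + M i 1 * N 1 j.
Proof.
by rewrite mxE big_ord_recl big_ord1 (_ : lift 0 0 = 1) //; exact/val_inj.
Qed.

Lemma mx22E (p q r s : S) :
  (mx22 p q r s 0 0 = p) * (mx22 p q r s 0 1 = q) *
  (mx22 p q r s 1 0 = r) * (mx22 p q r s 1 1 = s).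
Proof. by rewrite !mxE. Qed.

Lemma rowcolE m n (M : 'M[S]_(m, n)) i j :
  (row i M 0 j = M i j) * ((col j M)^T 0 i = M i j).
Proof. by rewrite !mxE. Qed.

Lemma wedge_mulmx (u v : 'rV[S]_2) M :
  wedge (u *m M) (v *m M) = wedge u v * \det M.
Proof. by rewrite /wedge det2 !mulmx2E; ring. Qed.

(** Multiplicativity of the determinant, for the matrix with rows u, u' times the matrix with
    columns v, v'. *)
Lemma wedge_pairing (u u' : 'rV[S]_2) (v v' : 'cV[S]_2) :
  (u *m v) 0 0 * (u' *m v') 0 0 - (u *m v') 0 0 * (u' *m v) 0 0
  = wedge u u' * cowedge v v'.
Proof. by rewrite /wedge /cowedge !mulmx2E; ring. Qed.

End Chain.

Section Transfer.

Variables (S : comNzRingType) (a : int -> int -> S) (w : seq letter).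

Local Notation B k := (Bmat a (point w k)).

(** Vertical dominoes are transposed so that the states at N and E steps live in one space. *)
Definition state r : 'rV[S]_2 :=
  if is_north (letter_at w r) then row 1 (B r) else (col 0 (B r))^T.
Definition exit s : 'rV[S]_2 :=
  if is_north (letter_at w s) then row 0 (B s.+1) else (col 1 (B s.+1))^T.
Definition costate s : 'cV[S]_2 := covec (is_north (letter_at w s)) (exit s).
Definition transfer r s : 'M[S]_2 :=
  chain (is_north (letter_at w r)) [seq B k | k <- bends w r s].

(** The height is an argument of [f] because [drh] counts cells from the bottom: it occurs in the
    entries as well as in the type, and both must be replaced together. *)
Lemma conform_square (T : nzRingType) n h k (f : nat -> nat -> nat -> T) :
  h = n -> k = n ->
  conform_mx (0 : 'M_n) (\matrix_(i < h, j < k) f h i j)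
  = \matrix_(i < n, j < n) f n i j.
Proof. by move=> -> ->; rewrite conform_mx_id. Qed.

Lemma is_north_neq x y : (x != y) = (is_north x (+) is_north y).
Proof. by case: x y => [] []. Qed.

Lemma std_cells r s : (r <= s)%N ->
  std a w r s = cells_mx (eta w r s)
    (domino (is_north (letter_at w r)) (state r) ::
     [seq Block C | C <- [seq B k | k <- bends w r s]] ++
     [:: domino (is_north (letter_at w s)) (exit s)])
    (is_north (letter_at w r)).
Proof.
move=> le_rs; have [hE kE] := std_dim a w le_rs; rewrite /std /drh.
set f := fun (h i j : nat) => cell (placed (std_pieces a w r s)) j (h.-1 - i).
rewrite (conform_square f hE kE) /f /cells_mx /placed /std_pieces -map_comp.
rewrite /std_first /std_last /state /exit.
by case: (letter_at w r); case: (letter_at w s); rewrite /= ?trmxK.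
Qed.

Lemma c_transfer r s : (r <= s)%N ->
  c a w r s = (state r *m transfer r s *m costate s) 0 0.
Proof.
move=> le_rs; rewrite /c std_cells // /transfer /costate.
have ob := odd_bends w le_rs; rewrite is_north_neq in ob.
(* The letter changes at each bend, so the parity of their number compares w_r with w_s. *)
have -> : is_north (letter_at w s) =
  is_north (letter_at w r) (+) odd (size [seq B k | k <- bends w r s]).
  by rewrite size_map ob addbA addbb.
by rewrite -det_cells size_map /eta !subSS !subn0.
Qed.

Lemma bends_cat r t s : (r <= t <= s)%N ->
  bends w r s = bends w r t ++ bends w t s.
Proof.
move=> /andP[le_rt le_ts]; rewrite /bends -filter_cat; congr (filter _ _).
by rewrite (_ : s - r = (t - r) + (s - t))%N ?iotaD ?addSn ?subnKC //; lia.
Qed.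

Lemma bends_step r :
  bends w r r.+1 = if letter_at w r != letter_at w r.+1 then [:: r.+1] else [::].
Proof. by rewrite /bends subSnn. Qed.

Lemma bends_nil r s x :
  (forall k, (r <= k <= s)%N -> letter_at w k = x) -> bends w r s = [::].
Proof.
move=> wx; apply/eqP; rewrite -(negbK (_ == _)) -has_filter -all_predC.
apply/allP => k; rewrite mem_iota /= => k_in.
by rewrite !wx ?eqxx //; lia.
Qed.

(** After the bends of [r,t] the chain has the direction of w_t, by parity, and so continues as the
    chain of [t,s]. *)
Lemma transfer_cat r t s : (r <= t <= s)%N ->
  transfer r s = transfer r t *m transfer t s.
Proof.
move=> rts; rewrite /transfer (bends_cat rts) map_cat chain_cat size_map.
rewrite odd_bends ?is_north_neq; last by case/andP: rts.
by rewrite addbA addbb.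
Qed.

Lemma transfer_id r : transfer r r = 1%:M.
Proof. by rewrite /transfer /bends subnn. Qed.

Lemma transfer_step r : transfer r r.+1 =
  if letter_at w r != letter_at w r.+1
  then turn (is_north (letter_at w r)) (B r.+1) else 1%:M.
Proof.
by rewrite /transfer bends_step; case: ifP => //= _; rewrite mulmx1.
Qed.

Lemma det_transfer r s :
  \det (transfer r s) = \prod_(k <- bends w r s) Delta a w k.
Proof. by rewrite det_chain big_map. Qed.

Lemma point_succ r : (0 < r)%N ->
  point w r.+1 = point w r + step (letter_at w r).
Proof. by case: r. Qed.

(** Consecutive blocks overlap, in a row after an N step and in a column after an E step; this turns
    products of entries of different blocks into the minors Delta_k. *)
Lemma Bmat_north r j : (0 < r)%N -> is_north (letter_at w r) ->
  B r.+1 1 j = B r 0 j.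
Proof.
move=> r0; rewrite !mxE point_succ //; case: (letter_at w r) => // _ /=.
by rewrite addr0 subr0 addrK.
Qed.

Lemma Bmat_east r i : (0 < r)%N -> ~~ is_north (letter_at w r) ->
  B r.+1 i 0 = B r i 1.
Proof.
move=> r0; rewrite !mxE point_succ //; case: (letter_at w r) => // _ /=.
by rewrite !addr0.
Qed.

Lemma letter_eq (x y z : letter) : x != z -> y != z -> x = y.
Proof. by case: x y z => [] [] []. Qed.

Lemma bends_detour r s : (r.+1 < s)%N -> letter_at w r = letter_at w s ->
    (forall k, (r < k < s)%N -> letter_at w k != letter_at w r) ->
  bends w r s = [:: r.+1; s].
Proof.
move=> lt_rs wrs w_between.
rewrite (@bends_cat r r.+1 s); last by lia.
rewrite (@bends_cat r.+1 s.-1 s); last by lia.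
rewrite (@bends_nil r.+1 s.-1 (letter_at w r.+1)) => [|k k_in]; last first.
  by apply: letter_eq (w_between _ _) (w_between _ _); lia.
have s0 : (0 < s)%N by lia.
rewrite -{2}(prednK s0) !bends_step (prednK s0).
by rewrite -wrs eq_sym !w_between //; lia.
Qed.

(** If s = r + 1, overlap makes the two states the two rows or columns of B(P_r). Otherwise the
    bends are r + 1 and s: turning at r + 1 gives a vector one coordinate of which is Delta_r, again
    by overlap, and turning at s and wedging with [state s] keeps only this coordinate, times
    Delta_s up to sign. *)
Lemma wedge_same_letter r s : (0 < r < s)%N -> letter_at w r = letter_at w s ->
    (forall k, (r < k < s)%N -> letter_at w k != letter_at w r) ->
  wedge (state r *m transfer r s) (state s) =
  (-1) ^+ is_north (letter_at w r) *
    (Delta a w r *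
     if letter_at w s.-1 != letter_at w s then Delta a w s else 1).
Proof.
move=> /andP[r0 lt_rs] wrs w_between; rewrite /state -wrs.
case: (ltnP r.+1 s) => [lt_r1s|le_sr1].
  rewrite w_between ?mulr1; last by lia.
  have wr1: is_north (letter_at w r.+1) = ~~ is_north (letter_at w r).
    have : letter_at w r.+1 != letter_at w r by apply: w_between; lia.
    by rewrite is_north_neq; do 2!case: is_north.
  have ws1 : is_north (letter_at w s) = is_north (letter_at w r) by rewrite wrs.
  rewrite /transfer bends_detour //= mulmx1 /Delta !det2 /wedge.
  case: (boolP (is_north (letter_at w r))) wr1 => wr wr1.
    rewrite !mulmx2E !mx22E !rowcolE !(Bmat_north _ r0 wr); ring.
  by rewrite !mulmx2E !mx22E !rowcolE !(Bmat_east _ r0 wr); ring.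
have {lt_rs w_between le_sr1}sE : s = r.+1 by lia.
move: sE wrs => -> wrs; rewrite /= wrs eqxx mulr1 transfer_step wrs eqxx mulmx1.
rewrite -wrs /Delta det2 /wedge.
case: (boolP (is_north (letter_at w r))) => wr.
  by rewrite !rowcolE !(Bmat_north _ r0 wr); ring.
by rewrite !rowcolE !(Bmat_east _ r0 wr); ring.
Qed.

Lemma transfer_corner r t s : (r < s)%N -> letter_at w r != letter_at w s ->
    (r < t <= s)%N ->
    (forall k, (r <= k < t)%N -> letter_at w k = letter_at w r) ->
    (forall k, (t <= k <= s)%N -> letter_at w k = letter_at w s) ->
  transfer r s = turn (is_north (letter_at w r)) (B t).
Proof.
move=> lt_rs wrs rts w_low w_high.
have wt : letter_at w t.-1 != letter_at w t.
  by rewrite (w_low t.-1) ?(w_high t) //; lia.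
have t0 : (0 < t)%N by lia.
rewrite /transfer (@bends_cat r t.-1 s); last by lia.
rewrite (@bends_cat t.-1 t s); last by lia.
rewrite (bends_nil (x := letter_at w r)) => [|k k_in]; last by apply: w_low; lia.
rewrite (@bends_nil t s (letter_at w s)) => [|k k_in]; last by apply: w_high; lia.
by rewrite -{2}(prednK t0) bends_step (prednK t0) wt /= mulmx1.
Qed.

(** Here s is the only bend. Turning there and wedging with [state s] keeps only the coordinate of
    [state r] that is the lower left entry of B(P_r), which is a_{11} when r = 1. *)
Lemma wedge_corner r s : (0 < r < s)%N -> letter_at w r != letter_at w s ->
    (forall k, (r <= k < s)%N -> letter_at w k = letter_at w r) ->
  wedge (state r *m transfer r s) (state s) =
  (-1) ^+ is_north (letter_at w s) * (B r 1 0 * Delta a w s).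
Proof.
move=> /andP[r0 lt_rs] wrs w_low.
rewrite (@transfer_corner r s s) ?lt_rs ?leqnn //; last first.
  by move=> k k_in; congr letter_at; lia.
rewrite /state /Delta det2 /wedge.
move: wrs; rewrite is_north_neq.
case: (is_north (letter_at w r)) (is_north (letter_at w s)) => [] [] //= _;
  by rewrite !mulmx2E !mx22E !rowcolE; ring.
Qed.

Lemma covecE up (v : 'rV[S]_2) :
  (covec up v 0 0 = (-1) ^+ up * v 0 1) * (covec up v 1 0 = (-1) ^+ up * - v 0 0).
Proof. by rewrite !mxE. Qed.

(** The dual of [wedge_same_letter]: the last dominoes are read at P_{r+1} and P_{s+1}, so the
    overlap is that of B(P_s) and B(P_{s+1}). *)
Lemma cowedge_same_letter r s : (0 < r < s)%N -> letter_at w r = letter_at w s ->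
    (forall k, (r < k < s)%N -> letter_at w k != letter_at w r) ->
  cowedge (costate r) (transfer r s *m costate s) =
  (-1) ^+ is_north (letter_at w r) *
    (Delta a w s.+1 *
     if letter_at w r != letter_at w r.+1 then Delta a w r.+1 else 1).
Proof.
move=> /andP[r0 lt_rs] wrs w_between; rewrite /costate /exit -wrs.
have s0 : (0 < s)%N by lia.
case: (ltnP r.+1 s) => [lt_r1s|le_sr1].
  rewrite eq_sym w_between ?mulr1; last by lia.
  have wr1: is_north (letter_at w r.+1) = ~~ is_north (letter_at w r).
    have : letter_at w r.+1 != letter_at w r by apply: w_between; lia.
    by rewrite is_north_neq; do 2!case: is_north.
  rewrite /transfer bends_detour //= mulmx1 /Delta !det2 /cowedge.
  case: (boolP (is_north (letter_at w r))) wr1 => wr wr1.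
    rewrite wrs in wr.
    rewrite !mulmx2E !mx22E !covecE !rowcolE !(Bmat_north _ s0 wr); ring.
  rewrite wrs in wr.
  by rewrite !mulmx2E !mx22E !covecE !rowcolE !(Bmat_east _ s0 wr); ring.
have {lt_rs w_between le_sr1}sE : s = r.+1 by lia.
move: sE s0 wrs => -> s0 wrs; rewrite /= wrs eqxx mulr1.
rewrite transfer_step wrs eqxx mul1mx.
rewrite /Delta det2 /cowedge.
case: (boolP (is_north (letter_at w r.+1))) => wr.
  by rewrite !covecE !rowcolE !(Bmat_north _ s0 wr); ring.
by rewrite !covecE !rowcolE !(Bmat_east _ s0 wr); ring.
Qed.

(** The dual of [wedge_corner]; the upper right entry of B(P_{s+1}) that remains is a_{pq} when s =
    l. *)
Lemma cowedge_corner r s : (0 < r < s)%N -> letter_at w r != letter_at w s ->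
    (forall k, (r < k <= s)%N -> letter_at w k = letter_at w s) ->
  cowedge (costate r) (transfer r s *m costate s) =
  (-1) ^+ is_north (letter_at w r) * (B s.+1 0 1 * Delta a w r.+1).
Proof.
move=> /andP[r0 lt_rs] wrs w_high.
rewrite (@transfer_corner r r.+1 s) ?lt_rs ?leqnn //; last first.
  by move=> k k_in; congr letter_at; lia.
rewrite /costate /exit /Delta det2 /cowedge.
move: wrs; rewrite is_north_neq.
case: (boolP (is_north (letter_at w r))) => wr;
case: (boolP (is_north (letter_at w s))) => ws //= _.
  by rewrite !mulmx2E !mx22E !covecE !rowcolE; ring.
by rewrite !mulmx2E !mx22E !covecE !rowcolE; ring.
Qed.

End Transfer.

(** * Consecutive entries of rho and kappa *)

Section SortedSeq.

Variable s : seq nat.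
Hypothesis s_sorted : sorted ltn s.

Lemma sorted_nth_lt i j : (i < j < size s)%N -> (nth 0%N s i < nth 0%N s j)%N.
Proof.
by case/andP=> lt_ij lt_j; apply: (sorted_ltn_nth ltn_trans) => //; rewrite inE; lia.
Qed.

Lemma sorted_nth_le i j : (i <= j < size s)%N -> (nth 0%N s i <= nth 0%N s j)%N.
Proof.
case/andP; rewrite leq_eqVlt => /orP[/eqP-> //|lt_ij] lt_j.
by apply/ltnW/sorted_nth_lt; rewrite lt_ij.
Qed.

Lemma sorted_nth_gap i k : (i.+1 < size s)%N ->
  (nth 0%N s i < k < nth 0%N s i.+1)%N -> k \notin s.
Proof.
move=> lt_i /andP[lt_ik lt_ki]; apply/negP => /(nthP 0%N)[j lt_j kE].
case: (leqP j i) => [le_ji|lt_ij].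
  have := @sorted_nth_le j i; rewrite le_ji (ltnW lt_i) kE => /(_ isT); lia.
have := @sorted_nth_le i.+1 j; rewrite lt_ij lt_j kE => /(_ isT); lia.
Qed.

Lemma sorted_nth_first k : k \in s -> (nth 0%N s 0 <= k)%N.
Proof.
by move=> /(nthP 0%N)[j lt_j <-]; exact: sorted_nth_le.
Qed.

Lemma sorted_nth_last k : k \in s -> (k <= nth 0%N s (size s).-1)%N.
Proof.
move=> /(nthP 0%N)[j lt_j <-]; apply: sorted_nth_le; move: lt_j.
by case: (size s) => // n; rewrite ltnS leqnn andbT.
Qed.

End SortedSeq.

Section RhoKappa.

Variable w : seq letter.

Lemma mem_indices x k :
  (k \in indices x w) = (0 < k <= size w)%N && (letter_at w k == x).
Proof. by rewrite mem_filter mem_iota andbC ltnS. Qed.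

Lemma indices_sorted x : sorted ltn (indices x w).
Proof. exact: sorted_filter ltn_trans _ _ (iota_ltn_sorted _ _). Qed.

Lemma size_indices : (size (indices East w) + size (indices North w) = size w)%N.
Proof.
rewrite !size_filter -[RHS](size_iota 1)
  -(count_predC (fun k => letter_at w k == East)).
by congr addn; apply: eq_count => k /=; case: letter_at.
Qed.

Lemma nth_indices x i : (i < size (indices x w))%N ->
  nth 0%N (indices x w) i \in indices x w.
Proof. exact: mem_nth. Qed.

Local Notation nE := (size (indices East w)).
Local Notation nN := (size (indices North w)).

Lemma rhoE i : rho w i = nth 0%N (rho_seq w) i.-1. Proof. by []. Qed.

Lemma kappaE i : kappa w i = nth 0%N (kappa_seq w) i.-1. Proof. by []. Qed.

Lemma rho_east i : (i < nE)%N -> rho w (nE - i) = nth 0%N (indices East w) i.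
Proof.
move=> lt_i; rewrite rhoE /rho_seq nth_cat size_rev nth_rev; last by lia.
by rewrite ifT; last lia; congr nth; lia.
Qed.

Lemma rho_north i : rho w (nE + i).+1 = nth 0%N (indices North w) i.
Proof. by rewrite rhoE /rho_seq nth_cat size_rev ltnNge leq_addr /= addKn. Qed.

Lemma kappa_east i : (i < nE)%N -> kappa w i.+1 = nth 0%N (indices East w) i.
Proof. by move=> lt_i; rewrite kappaE /kappa_seq nth_cat lt_i. Qed.

Lemma kappa_north i : (i < nN)%N ->
  kappa w (size w - i) = nth 0%N (indices North w) i.
Proof.
move=> lt_i; rewrite kappaE /kappa_seq nth_cat -size_indices.
rewrite ifN; last by lia.
by rewrite nth_rev; last lia; congr nth; lia.
Qed.

(** Consecutive entries of rho are two neighbouring E-indices, two neighbouring N-indices, or the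
    first E-index and the first N-index. The boolean is the test made in [Fset], which case analysis
    on [rhoP] therefore decides. *)
Variant rho_spec : bool -> nat -> nat -> Type :=
  | RhoEast r r' of (0 < r' < r)%N & (r <= size w)%N
    & letter_at w r = East & letter_at w r' = East
    & (forall k, (r' < k < r)%N -> letter_at w k != East) :
    rho_spec false r r'
  | RhoNorth r r' of (0 < r < r')%N & (r' <= size w)%N
    & letter_at w r = North & letter_at w r' = North
    & (forall k, (r < k < r')%N -> letter_at w k != North) :
    rho_spec false r r'
  | RhoCorner r r' of (0 < r <= size w)%N & (0 < r' <= size w)%N
    & letter_at w r = East & letter_at w r' = North
    & (forall k, (0 < k < r)%N -> letter_at w k = North)
    & (forall k, (0 < k < r')%N -> letter_at w k = East) :
    rho_spec true r r'.

Lemma indices_consecutive x i (r := nth 0%N (indices x w) i)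
    (r' := nth 0%N (indices x w) i.+1) : (i.+1 < size (indices x w))%N ->
  [/\ (0 < r < r')%N, (r' <= size w)%N, letter_at w r = x, letter_at w r' = x
    & forall k, (r < k < r')%N -> letter_at w k != x].
Proof.
move=> lt_i; have xs := indices_sorted x.
have := nth_indices lt_i; have := nth_indices (ltnW lt_i).
rewrite !mem_indices -/r -/r' => /andP[r_in /eqP wr] /andP[r'_in /eqP wr'].
have lt_rr' : (r < r')%N by apply: sorted_nth_lt => //; lia.
split=> // [||k k_in]; try lia.
have := sorted_nth_gap xs lt_i k_in; rewrite mem_indices negb_and.
by case/orP => //; lia.
Qed.

Lemma rhoP a : (1 <= a <= size w - 1)%N ->
  rho_spec ((rho w a \in indices East w) && (rho w a.+1 \in indices North w))
    (rho w a) (rho w a.+1).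
Proof.
rewrite -size_indices => a_in; case: (ltngtP a nE) => [lt_a|gt_a|aE].
- have aE : a = (nE - (nE - a.+1).+1)%N by lia.
  have -> : rho w a.+1 = nth 0%N (indices East w) (nE - a.+1).
    by rewrite -rho_east; last lia; congr rho; lia.
  have -> : rho w a = nth 0%N (indices East w) (nE - a.+1).+1.
    by rewrite -rho_east; last lia; congr rho; lia.
  have [|r0 rl wr wr' w_between] := @indices_consecutive East (nE - a.+1).
    by lia.
  rewrite [X in _ && X]mem_indices wr /= !andbF.
  by constructor.
- have -> : rho w a.+1 = nth 0%N (indices North w) (a - nE.+1).+1.
    by rewrite -rho_north; congr rho; lia.
  have -> : rho w a = nth 0%N (indices North w) (a - nE.+1).
    by rewrite -rho_north; congr rho; lia.
  have [|r0 rl wr wr' w_between] := @indices_consecutive North (a - nE.+1).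
    by lia.
  rewrite mem_indices wr /= !andbF.
  by constructor.
have lt_E : (0 < nE)%N by lia.
have lt_N : (0 < nN)%N by lia.
have -> : rho w a.+1 = nth 0%N (indices North w) 0 by rewrite aE -[nE]addn0 rho_north.
have -> : rho w a = nth 0%N (indices East w) 0 by rewrite aE -rho_east ?subn0.
rewrite !nth_indices //.
have := nth_indices lt_E; have := nth_indices lt_N.
rewrite !mem_indices => /andP[r'_in /eqP wr'] /andP[r_in /eqP wr].
have first_idx x k : (0 < size (indices x w))%N ->
    (0 < k < nth 0%N (indices x w) 0)%N -> letter_at w k != x.
  move=> /nth_indices + /andP[k0 lt_k]; rewrite mem_indices => /andP[x_in _].
  apply/negP => wk; suff /(sorted_nth_first (indices_sorted x)) : k \in indices x w.
    by lia.
  by rewrite mem_indices wk andbT; lia.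
constructor => // k k_in.
  by have := first_idx East k lt_E k_in; case: letter_at.
by have := first_idx North k lt_N k_in; case: letter_at.
Qed.

(** The analogue for kappa, whose corner pair consists of the last E-index and the last N-index. *)
Variant kappa_spec : bool -> nat -> nat -> Type :=
  | KappaEast s s' of (0 < s < s')%N & (s' <= size w)%N
    & letter_at w s = East & letter_at w s' = East
    & (forall k, (s < k < s')%N -> letter_at w k != East) :
    kappa_spec false s s'
  | KappaNorth s s' of (0 < s' < s)%N & (s <= size w)%N
    & letter_at w s = North & letter_at w s' = North
    & (forall k, (s' < k < s)%N -> letter_at w k != North) :
    kappa_spec false s s'
  | KappaCorner s s' of (0 < s <= size w)%N & (0 < s' <= size w)%N
    & letter_at w s = East & letter_at w s' = North
    & (forall k, (s < k <= size w)%N -> letter_at w k = North)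
    & (forall k, (s' < k <= size w)%N -> letter_at w k = East) :
    kappa_spec true s s'.

Lemma kappaP b : (1 <= b <= size w - 1)%N ->
  kappa_spec
    ((kappa w b \in indices East w) && (kappa w b.+1 \in indices North w))
    (kappa w b) (kappa w b.+1).
Proof.
move=> b_in; have szE := size_indices; case: (ltngtP b nE) => [lt_b|gt_b|bE].
- have -> : kappa w b.+1 = nth 0%N (indices East w) b.-1.+1.
    by rewrite -kappa_east; last lia; congr kappa; lia.
  have -> : kappa w b = nth 0%N (indices East w) b.-1.
    by rewrite -kappa_east; last lia; congr kappa; lia.
  have [|r0 rl wr wr' w_between] := @indices_consecutive East b.-1.
    by lia.
  rewrite [X in _ && X]mem_indices wr' /= !andbF.
  by constructor.
- have -> : kappa w b.+1 = nth 0%N (indices North w) (size w - b.+1).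
    by rewrite -kappa_north; last lia; congr kappa; lia.
  have -> : kappa w b = nth 0%N (indices North w) (size w - b.+1).+1.
    by rewrite -kappa_north; last lia; congr kappa; lia.
  have [|r0 rl wr wr' w_between] := @indices_consecutive North (size w - b.+1).
    by lia.
  rewrite mem_indices wr' /= !andbF.
  by constructor.
have lt_E : (0 < nE)%N by lia.
have lt_N : (0 < nN)%N by lia.
have -> : kappa w b.+1 = nth 0%N (indices North w) nN.-1.
  by rewrite -kappa_north; last lia; congr kappa; lia.
have -> : kappa w b = nth 0%N (indices East w) nE.-1.
  by rewrite -kappa_east; last lia; congr kappa; lia.
have last_in x : (0 < size (indices x w))%N ->
    nth 0%N (indices x w) (size (indices x w)).-1 \in indices x w.
  by move=> lt0; apply: nth_indices; lia.
rewrite !last_in //.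
have := last_in _ lt_E; have := last_in _ lt_N.
rewrite !mem_indices => /andP[s'_in /eqP ws'] /andP[s_in /eqP ws].
have last_idx x k : (0 < size (indices x w))%N ->
    (nth 0%N (indices x w) (size (indices x w)).-1 < k <= size w)%N ->
    letter_at w k != x.
  move=> lt0 /andP[lt_k kl].
  apply/negP => wk; suff /(sorted_nth_last (indices_sorted x)) : k \in indices x w.
    by lia.
  by rewrite mem_indices wk andbT; lia.
constructor => // k k_in.
  by have := last_idx East k lt_E k_in; case: letter_at.
by have := last_idx North k lt_N k_in; case: letter_at.
Qed.

Lemma rho_bounds e r r' : rho_spec e r r' ->
  (0 < minn r r' < maxn r r')%N /\ (e -> minn r r' = 1%N).
Proof.
case=> {}r {}r'; try by split=> //; lia.
move=> r_in r'_in wr wr' w_low w_low'.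
have neq_r : r != r' by apply/eqP => rE; rewrite rE wr' in wr.
split=> [|_]; first by lia.
apply/eqP; rewrite eqn_leq [X in _ && X](_ : _ = true) ?andbT; last by lia.
rewrite leqNgt; apply/negP => min_gt1.
(* Otherwise index 1 precedes both the first E-index and the first N-index, and would carry both
   letters. *)
have w1 : letter_at w 1 = East by apply: w_low'; lia.
by rewrite w_low // in w1; lia.
Qed.

Lemma kappa_bounds e s s' : kappa_spec e s s' ->
  (minn s s' < maxn s s')%N /\ (e -> maxn s s' = size w).
Proof.
case=> {}s {}s'; try by split=> //; lia.
move=> s_in s'_in ws ws' w_high w_high'.
have neq_s : s != s' by apply/eqP => sE; rewrite sE ws' in ws.
split=> [|_]; first by lia.
apply/eqP; rewrite eqn_leq (_ : (maxn s s' <= size w)%N = true) /=; last by lia.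
rewrite leqNgt; apply/negP => max_lt.
have wl : letter_at w (size w) = North by apply: w_high; lia.
by rewrite w_high' // in wl; lia.
Qed.

End RhoKappa.

(** * The left-hand side as a product of three 2x2 determinants *)

Section Plucker.

Variables (S : comNzRingType) (a : int -> int -> S) (w : seq letter).

Local Notation B k := (Bmat a (point w k)).

Lemma wedgeC (u v : 'rV[S]_2) : wedge u v = - wedge v u.
Proof. by rewrite /wedge; ring. Qed.

Lemma cowedgeC (u v : 'cV[S]_2) : cowedge u v = - cowedge v u.
Proof. by rewrite /cowedge; ring. Qed.

Lemma walk_count n : (n <= size w)%N ->
  walk w n =
    (1 + (count_mem East (take n w))%:Z, 1 + (count_mem North (take n w))%:Z).
Proof.
elim: n => [|n IH] lt_n; first by rewrite take0.
rewrite /= IH ?(ltnW lt_n) // (take_nth North) // -cats1 !count_cat /letter_at /=.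
by case: (nth _ _ _); congr (_, _); rewrite /=; lia.
Qed.

Lemma Bmat_first : B 1 1 0 = a 1 1.
Proof. by rewrite mxE /= addr0. Qed.

Lemma Bmat_last : B (size w).+1 0 1 = a (ncols w)%:Z (nrows w)%:Z.
Proof.
rewrite mxE /point walk_count // take_size /= /ncols /nrows.
by congr (a _ _); rewrite /=; lia.
Qed.

(** All signs cancel: the arguments have to be swapped exactly when the larger of r and r' carries
    N, and exactly then the wedge lemmas give -1. This is the effect of listing E-indices downwards
    and N-indices upwards. *)
Lemma wedge_rho e r r' (m := maxn r r') : rho_spec w e r r' ->
  wedge (state a w r' *m transfer a w r' m) (state a w r *m transfer a w r m) =
  (if e then a 1 1 else Delta a w (minn r r')) *
  (if letter_at w m.-1 != letter_at w m then Delta a w m else 1).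
Proof.
rewrite {}/m => spec; have [_] := rho_bounds spec; case: spec => {}r {}r'.
- move=> r_in rl wr wr' w_between _.
  rewrite (maxn_idPl _) ?(minn_idPr _); try lia.
  rewrite transfer_id mulmx1 wedge_same_letter ?wr ?wr' //=.
  by rewrite mul1r.
- move=> r_in rl wr wr' w_between _.
  rewrite (maxn_idPr _) ?(minn_idPl _); try lia.
  rewrite transfer_id mulmx1 wedgeC wedge_same_letter ?wr ?wr' //=.
  by rewrite expr1 mulN1r opprK.
move=> r_in r'_in wr wr' w_low w_low' /(_ isT) min1.
case: (ltngtP r r') => [lt_r|lt_r|rE]; last by rewrite rE wr' in wr.
- have r1 : r = 1%N by lia.
  rewrite transfer_id mulmx1 wedgeC wedge_corner; last 3 first.
  + by lia.
  + by rewrite wr wr'.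
  + by move=> k k_in; rewrite wr w_low' //; lia.
  rewrite wr' r1 Bmat_first [r'.-1 in RHS]/= w_low' ?wr' /=; last by lia.
  by rewrite expr1 mulN1r opprK.
have r1 : r' = 1%N by lia.
rewrite transfer_id mulmx1 wedge_corner; last 3 first.
+ by lia.
+ by rewrite wr wr'.
+ by move=> k k_in; rewrite wr' w_low //; lia.
rewrite wr r1 Bmat_first w_low ?wr /=; last by lia.
by rewrite mul1r.
Qed.

(** As in [wedge_rho], except that the smaller of s and s' decides both the swap and the sign. *)
Lemma cowedge_kappa e s s' (n := minn s s') : kappa_spec w e s s' ->
  cowedge (transfer a w n s *m costate a w s) (transfer a w n s' *m costate a w s') =
  (if e then a (ncols w)%:Z (nrows w)%:Z else Delta a w (maxn s s').+1) *
  (if letter_at w n != letter_at w n.+1 then Delta a w n.+1 else 1).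
Proof.
rewrite {}/n => spec; have [_] := kappa_bounds spec; case: spec => {}s {}s'.
- move=> s_in sl ws ws' w_between _.
  rewrite (minn_idPl _) ?(maxn_idPr _); try lia.
  rewrite transfer_id mul1mx cowedge_same_letter ?ws ?ws' //=.
  by rewrite mul1r.
- move=> s_in sl ws ws' w_between _.
  rewrite (minn_idPr _) ?(maxn_idPl _); try lia.
  rewrite transfer_id mul1mx cowedgeC cowedge_same_letter ?ws ?ws' //=.
  by rewrite expr1 mulN1r opprK.
move=> s_in s'_in ws ws' w_high w_high' /(_ isT) maxE.
case: (ltngtP s s') => [lt_s|lt_s|sE]; last by rewrite sE ws' in ws.
- have s'E : s' = size w by lia.
  rewrite transfer_id mul1mx cowedge_corner; last 3 first.
  + by lia.
  + by rewrite ws ws'.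
  + by move=> k k_in; rewrite ws' w_high //; lia.
  rewrite ws s'E Bmat_last w_high /=; last by lia.
  by rewrite mul1r.
have sE : s = size w by lia.
rewrite transfer_id mul1mx cowedgeC cowedge_corner; last 3 first.
+ by lia.
+ by rewrite ws ws'.
+ by move=> k k_in; rewrite ws w_high' //; lia.
rewrite ws' sE Bmat_last w_high' /=; last by lia.
by rewrite expr1 mulN1r opprK.
Qed.

Lemma plucker r r' s s' (m := maxn r r') (n := minn s s') : (m <= n)%N ->
  c a w r' s * c a w r s' - c a w r' s' * c a w r s =
  wedge (state a w r' *m transfer a w r' m) (state a w r *m transfer a w r m) *
  (\prod_(k <- bends w m n) Delta a w k) *
  cowedge (transfer a w n s *m costate a w s)
    (transfer a w n s' *m costate a w s').
Proof.
move=> le_mn.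
have cE p q : (p <= m)%N -> (n <= q)%N -> c a w p q =
    ((state a w p *m transfer a w p m *m transfer a w m n) *m
     (transfer a w n q *m costate a w q)) 0 0.
  move=> le_pm le_nq; rewrite c_transfer; last by lia.
  rewrite (@transfer_cat _ _ _ p m q); last by lia.
  by rewrite (@transfer_cat _ _ _ m n q) ?mulmxA //; lia.
have [r_m r'_m] : (r <= m)%N /\ (r' <= m)%N by rewrite leq_maxl leq_maxr.
have [s_n s'_n] : (n <= s)%N /\ (n <= s')%N by rewrite geq_minl geq_minr.
by rewrite !cE // wedge_pairing wedge_mulmx det_transfer.
Qed.

End Plucker.

(** * The product over F(a,b) *)

Lemma DeltaE (S : comNzRingType) (a : int -> int -> S) w k
    (x := (point w k).1) (y := (point w k).2) :
  Delta a w k = a x (y + 1) * a (x + 1) y - a (x + 1) (y + 1) * a x y.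
Proof.
have e0 : x + 0%Z = x by exact: addr0.
have e1 : y + 1 - 0%Z = y + 1 by exact: subr0.
have e2 : y + 1 - Posz (1 %% 2) = y by exact: addrK.
by rewrite /Delta det2 !mxE /= e0 e1 e2.
Qed.

(** * Distinctness of the elements of F(a,b) in the polynomial ring *)

Section Indeterminates.

Variable R : comNzRingType.

Definition mono1 (i : int * int) : {cmonom (int * int)%type} := ucm i.

Definition mono2 (i j : int * int) : {cmonom (int * int)%type} :=
  mmul (mono1 i) (mono1 j).

Lemma mono1E i k : mono1 i k = (i == k).
Proof. exact: cmU. Qed.

Lemma mono2E i j k : mono2 i j k = ((i == k) + (j == k))%N.
Proof. by rewrite cmM !mono1E. Qed.

Lemma mono1_inj : injective mono1.
Proof.
move=> i j /(congr1 (fun m : {cmonom _} => m j)); rewrite !mono1E eqxx.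
by case: eqP.
Qed.

Lemma mono1_neq_mono2 i j k : mono1 i != mono2 j k.
Proof.
apply/eqP => /(congr1 (fun m : {cmonom _} => m _)) E.
have ij : i = j by have := E j; rewrite mono2E mono1E eqxx; case: eqP.
by have := E k; rewrite mono2E mono1E eqxx ij; case: (j == k).
Qed.

Lemma mono2_inj i j k l : mono2 i j = mono2 k l ->
  i = k /\ j = l \/ i = l /\ j = k.
Proof.
move=> /(congr1 (fun m : {cmonom _} => m _)) E.
have : (i == k) || (i == l).
  have := E i; rewrite !mono2E eqxx ![_ == i]eq_sym.
  by case: (i == k); case: (i == l).
case/orP => /eqP iE; [left | right]; split=> //; rewrite {}iE in E *; apply/eqP.
  have := E j; rewrite !mono2E eqxx [l == j]eq_sym.
  by move=> /addnI; case: (j == l).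
have := E j; rewrite !mono2E eqxx [k == j]eq_sym addnC.
by move=> /addIn; case: (j == k).
Qed.

(* The product is taken in a generic ring S so that it is elaborated at the ring
   structure on which Delta is instantiated. *)
Lemma coef_indetM i j k l m :
  mcoeff m ((fun (S : comNzRingType) (a : int -> int -> S) => a i j * a k l)
              _ (indet R))
  = (mono2 (i, j) (k, l) == m)%:R.
Proof. by cbv beta; rewrite malgM_def fgmulUU mulr1 mcoeffU1. Qed.

Lemma coef_indet i j m : mcoeff m (indet R i j) = (mono1 (i, j) == m)%:R.
Proof. exact: mcoeffU1. Qed.

(** The name refers to the lattice direction x + y = const; in the matrix B(P) these two entries
    form the main diagonal. *)
Definition antidiagonal (P : int * int) : {cmonom (int * int)%type} :=
  mono2 (P.1, P.2 + 1) (P.1 + 1, P.2).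

(* Only Delta at P has the antidiagonal product of B(P) among its monomials, which
   separates the Delta_k, so that F(a,b) has no accidental coincidences. *)
Lemma coef_Delta w k P :
  mcoeff (antidiagonal P) (Delta (indet R) w k) = (point w k == P)%:R.
Proof.
have -> : mcoeff (antidiagonal P) (Delta (indet R) w k) =
    (antidiagonal (point w k) == antidiagonal P)%:R -
    (mono2 ((point w k).1 + 1, (point w k).2 + 1)
       ((point w k).1, (point w k).2) == antidiagonal P)%:R.
  by rewrite -!coef_indetM DeltaE; exact: mcoeffB.
case: (point w k) P => [x y] [x' y'] /=.
have /negPf-> : mono2 (x + 1, y + 1) (x, y) != antidiagonal (x', y').
  by apply/eqP => /mono2_inj[][[? ?] [? ?]]; lia.
rewrite subr0; congr (nat_of_bool _)%:R; apply/eqP/eqP => [|-> //].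
by case/mono2_inj => -[[? ?] [? ?]]; congr (_, _); lia.
Qed.

Lemma natr_bool_inj : injective (fun b : bool => b%:R : R).
Proof.
by case=> [] [] //= /eqP; rewrite mulr1n mulr0n ?oner_eq0 // eq_sym oner_eq0.
Qed.

Lemma Delta_inj w k k' : Delta (indet R) w k = Delta (indet R) w k' ->
  point w k = point w k'.
Proof.
move=> eq_Delta; have := coef_Delta w k (point w k); rewrite eq_Delta.
move=> /(etrans (esym (coef_Delta _ _ _)))/natr_bool_inj.
by rewrite eqxx => /eqP.
Qed.

Lemma indet_neq_Delta w k i j : indet R i j != Delta (indet R) w k.
Proof.
apply/eqP => eq_Delta; have := coef_Delta w k (point w k); rewrite -eq_Delta.
move=> /(etrans (esym (coef_indet _ _ _)))/natr_bool_inj.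
by rewrite eqxx (negPf (mono1_neq_mono2 _ _ _)).
Qed.

Lemma indet_inj i j i' j' : indet R i j = indet R i' j' -> (i, j) = (i', j').
Proof.
move=> eq_a; have := coef_indet i j (mono1 (i', j')); rewrite eq_a.
move=> /(etrans (esym (coef_indet _ _ _)))/natr_bool_inj.
by rewrite eqxx => /esym/eqP/mono1_inj.
Qed.

End Indeterminates.

(** Each step raises x + y by one, which makes the points P_k distinct. *)
Lemma walk_sum w n : (walk w n).1 + (walk w n).2 = n.+2%:Z.
Proof.
elim: n => [//|n IH] /=; case: letter_at => /=; lia.
Qed.

Lemma point_inj w : {in [pred k | 0 < k]%N &, injective (point w)}.
Proof.
move=> [|k] [|k'] //= _ _; rewrite /point /= => E.
by have := walk_sum w k; have := walk_sum w k'; rewrite E => -> [->].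
Qed.

Lemma mem_bends w r s k : (k \in bends w r s) =
  (r < k <= s)%N && (letter_at w k.-1 != letter_at w k).
Proof.
rewrite mem_filter mem_iota andbC; congr (_ && _).
by apply/idP/idP; lia.
Qed.

(** * Enumeration of F(a,b) and the product over it *)

Section ProdFset.

Local Open Scope fset_scope.

(** Each modification in F(a,b) exchanges one element; carrying a duplicate-free list along with the
    set keeps the product computable. *)
Lemma fset_replace (T : choiceType) (F : {fset T}) x p t :
    F =i x :: t -> uniq (x :: t) -> p \notin x :: t ->
  p |` (F `\ x) =i p :: t /\ uniq (p :: t).
Proof.
move=> FE /= /andP[x_t t_uniq]; rewrite inE negb_or => /andP[px p_t].
split=> [z|]; last by rewrite /= p_t.
rewrite in_fset1U in_fsetD1 FE !inE; case: (z =P p) => //= _.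
by case: (z =P x) => //= ->; rewrite (negPf x_t).
Qed.

Lemma in_fset_map (T : choiceType) (f : nat -> T) (s : seq nat) z :
  (z \in [fset f k | k in s]) = (z \in [seq f k | k <- s]).
Proof. by apply/imfsetP/mapP. Qed.

Variables (S : comNzRingType) (A : int -> int -> S) (w : seq letter).

Local Notation D := (Delta A w).
Local Notation a11 := (A 1 1).
Local Notation apq := (A (ncols w)%:Z (nrows w)%:Z).

Hypothesis D_inj : {in [pred k | 0 < k]%N &, injective D}.
Hypothesis a11_D : forall k, a11 != D k.
Hypothesis apq_D : forall k, apq != D k.
Hypothesis a11_apq : a11 != apq.

(** A product over a set counts equal elements once, so the proof lists the elements without
    repetition by means of the distinctness hypotheses of the section. The conditions on [e] and [f]
    make the removed Delta that of an endpoint of mu'' = [l,h]. *)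
Lemma prod_bends_endpoints (l m n h : nat) (e f : bool)
    (F0 := [fset D k | k in bends w m n] `|` [fset D k | k in endpoints l h] `|`
       [fset D k | k in [seq k <- endpoints m n | k \in bends w l h]])
    (F1 := if f then apq |` (F0 `\ D (size w).+1) else F0)
    (F2 := if e then a11 |` (F1 `\ D 1) else F1) :
    (0 < l < m)%N -> (m <= n < h)%N -> (e -> l = 1%N) -> (f -> h = size w) ->
  \prod_(X <- F2) X =
  (if e then a11 else D l) * (if f then apq else D h.+1) *
  ((\prod_(k <- bends w m n) D k) *
   ((if letter_at w m.-1 != letter_at w m then D m else 1) *
    (if letter_at w n != letter_at w n.+1 then D n.+1 else 1))).
Proof.
move=> lm mnh eE fE.
(* All these indices lie strictly between l and h + 1, and the bends of [m,n] avoid m and n + 1, so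
   no index is listed twice. *)
pose t := bends w m n ++ [seq k <- endpoints m n | k \in bends w l h].
have m_bend : (m \in bends w l h) = (letter_at w m.-1 != letter_at w m).
  by rewrite mem_bends (_ : (l < m <= h)%N) //; lia.
have n_bend : (n.+1 \in bends w l h) = (letter_at w n != letter_at w n.+1).
  by rewrite mem_bends (_ : (l < n.+1 <= h)%N) //; lia.
have t_prod : \prod_(X <- map D t) X = \prod_(k <- bends w m n) D k *
   ((if letter_at w m.-1 != letter_at w m then D m else 1) *
    (if letter_at w n != letter_at w n.+1 then D n.+1 else 1)).
  rewrite big_map big_cat /= m_bend n_bend; congr (_ * _).
  by case: ifP => _; case: ifP => _; rewrite ?big_cons ?big_nil ?mulr1 ?mul1r.
rewrite -{}t_prod.
have F0E : F0 =i [:: D l, D h.+1 & map D t].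
  move=> z; rewrite !in_fsetU !in_fset_map map_cat !inE mem_cat /=.
  by case: (z == D l); case: (z == D h.+1); rewrite /= ?orbT ?orbF.
have D_uniq : uniq [:: D l, D h.+1 & map D t].
  have t_in k : k \in t -> (l < k < h.+1)%N.
    rewrite mem_cat mem_filter mem_bends /endpoints !inE.
    by case/orP => [/andP[]|/andP[_ /orP[]/eqP->]]; lia.
  rewrite -!map_cons map_inj_in_uniq => [|k k']; last first.
    rewrite !inE => k_in k'_in; apply: D_inj; rewrite inE.
      by case/or3P: k_in => [/eqP->|/eqP->|/t_in]; lia.
    by case/or3P: k'_in => [/eqP->|/eqP->|/t_in]; lia.
  rewrite /= inE negb_or -andbA; apply/and4P; split.
  - by apply/eqP; lia.
  - by apply/negP => /t_in; lia.
  - by apply/negP => /t_in; lia.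
  have uniq_mn : uniq (endpoints m n) by rewrite /= inE andbT; apply/eqP; lia.
  rewrite cat_uniq !filter_uniq ?iota_uniq // andbT.
  apply/hasPn => k; rewrite mem_filter /endpoints !inE => /andP[_ k_mn].
  by apply/negP; rewrite mem_bends; case/orP: k_mn => /eqP->; lia.
pose Y := if f then apq else D h.+1.
have [F1E F1_uniq] : F1 =i [:: Y, D l & map D t] /\ uniq [:: Y, D l & map D t].
  (* [fset_replace] exchanges the head of the list, so the element to be removed is moved to the
     front. *)
  have perm_D : perm_eq [:: D l, D h.+1 & map D t] [:: D h.+1, D l & map D t].
    exact/permPl/(perm_catCA [:: _] [:: _]).
  have F0E' z : (z \in F0) = (z \in [:: D h.+1, D l & map D t]).
    by rewrite F0E (perm_mem perm_D).
  rewrite (perm_uniq perm_D) in D_uniq.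
  rewrite /F1 /Y; case: (f) fE => // /(_ isT) <-; apply: fset_replace => //.
  rewrite !inE !(negPf (apq_D _)) /=.
  by apply/mapP => -[k _ /eqP]; rewrite (negPf (apq_D k)).
pose X := if e then a11 else D l.
have [F2E F2_uniq] : F2 =i [:: X, Y & map D t] /\
    uniq [:: X, Y & map D t].
  have perm_D : perm_eq [:: Y, D l & map D t] [:: D l, Y & map D t].
    exact/permPl/(perm_catCA [:: _] [:: _]).
  have F1E' z : (z \in F1) = (z \in [:: D l, Y & map D t]).
    by rewrite F1E (perm_mem perm_D).
  rewrite (perm_uniq perm_D) in F1_uniq.
  rewrite /F2 /X.
  case: (e) eE => // /(_ isT) l1; rewrite -l1; apply: fset_replace => //.
  rewrite !inE !(negPf (a11_D _)) /= negb_or; apply/andP; split.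
    by rewrite /Y; case: (f).
  by apply/mapP => -[k _ /eqP]; rewrite (negPf (a11_D k)).
rewrite (perm_big _ (uniq_perm (fset_uniq _) F2_uniq F2E)) /= !big_cons mulrA.
by rewrite /X /Y.
Qed.

Lemma quadruple_relation a b : quadruple w a b ->
  c A w (rho w a.+1) (kappa w b) * c A w (rho w a) (kappa w b.+1) -
  c A w (rho w a.+1) (kappa w b.+1) * c A w (rho w a) (kappa w b) =
  \prod_(X <- Fset A w a b) X.
Proof.
case=> /rhoP rho_a /kappaP kappa_b le_rs.
have [lm e1] := rho_bounds rho_a; have [nh fl] := kappa_bounds kappa_b.
have le_mn : (maxn (rho w a) (rho w a.+1) <= minn (kappa w b) (kappa w b.+1))%N.
  by rewrite geq_max !leq_min !le_rs // !inE eqxx ?orbT.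
rewrite plucker // (wedge_rho _ rho_a) (cowedge_kappa _ kappa_b).
have mnh : (maxn (rho w a) (rho w a.+1) <= minn (kappa w b) (kappa w b.+1)
    < maxn (kappa w b) (kappa w b.+1))%N by rewrite le_mn nh.
rewrite [RHS](prod_bends_endpoints lm mnh e1 fl).
by ring.
Qed.

End ProdFset.

Theorem theorem8p3 (R : comNzRingType) (w : seq letter)
  (hw : (1 <= size w)%N) (a b : nat) (hab : quadruple w a b) :
  c (indet R) w (rho w a.+1) (kappa w b) *
    c (indet R) w (rho w a) (kappa w b.+1) -
  c (indet R) w (rho w a.+1) (kappa w b.+1) *
    c (indet R) w (rho w a) (kappa w b) =
  \prod_(X <- Fset (indet R) w a b) X.
Proof.
apply: quadruple_relation hab => [k k' k0 k'0 /Delta_inj|k|k|].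
- exact: point_inj.
- exact: indet_neq_Delta.
- exact: indet_neq_Delta.
(* Both p and q are at least 2, so (p, q) differs from (1, 1). *)
by apply/eqP => /indet_inj[].
Qed.
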